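(* Let $n\ge1$, suppose $\lambda\ge\frac{n+2}{n}$ and $\gamma=\frac{n+2-\varepsilon}{2\lambda}$ for some $\varepsilon\in(0,1)$. Then the function $$u(x,t)=\Psi(x,t):=\int_{\mathbb{R}^n}\Phi(x-y,t)|y|^{-2\gamma}\,dy$$ is a $C^\infty$ positive solution of $u_t-\Delta u=0$ in $\mathbb{R}^n\times(0,\infty)$ such that $u\in L^\lambda(\mathbb{R}^n\times(0,T))$ for all $T>0$, $t^\gamma u(0,t)=u(0,1)$ for all $t>0$, and $t^\gamma u(x,t)$ is bounded between positive constants on the set $\{(x,t)\in\mathbb{R}^n\times(0,\infty):|x|<\sqrt t\}$.
   Context: $\Phi$ is the heat kernel: $\Phi(x,t)=(4\pi t)^{-n/2}e^{-|x|^2/(4t)}$ for $t>0$ and $\Phi(x,t)=0$ for $t\le0$. *)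

(* Defs.v *)
From HB Require Import structures.
From mathcomp Require Import all_boot all_order all_algebra.
From mathcomp Require Import all_classical all_reals all_analysis.
Set Implicit Arguments. Unset Strict Implicit. Unset Printing Implicit Defensive.
Import Order.TTheory GRing.Theory Num.Theory.
Import numFieldNormedType.Exports.
Local Open Scope classical_set_scope.
Local Open Scope ring_scope.

(* Euclidean norm |x| (the library norm on 'rV is the max norm). *)
Definition enorm (R : realType) (n : nat) (x : 'rV[R]_n) : R :=
  Num.sqrt (\sum_(i < n) x ord0 i ^+ 2).

Definition heat_kernel (R : realType) (n : nat) (x : 'rV[R]_n) (t : R) : R :=
  if 0 < t then
    powR (4 * pi * t) (- (n%:R / 2)) * expR (- (enorm x ^+ 2) / (4 * t))
  else 0.

(* Iterated Lebesgue integral over R^k of f : (nat -> R) -> \bar R,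
   integrating coordinates k-1, ..., 0 (outermost first). *)
Fixpoint iter_int (R : realType) (k : nat) (f : (nat -> R) -> \bar R) : \bar R :=
  match k with
  | 0 => f (fun _ => 0)
  | k'.+1 => (\int[@lebesgue_measure R]_(s in [set: R])
               iter_int k' (fun c => f (fun j => if j == k' then s else c j)))%E
  end.

(* Integral over R^n of a NONNEGATIVE function F : 'rV[R]_n -> \bar R,
   computed as an iterated integral (equal to the Lebesgue integral on R^n
   for nonnegative measurable F by Tonelli). *)
Definition Rn_int (R : realType) (n : nat) (F : 'rV[R]_n -> \bar R) : \bar R :=
  iter_int n (fun c => F (\row_(i < n) c (nat_of_ord i))).

Definition Psi_ext (R : realType) (n : nat) (gamma : R) (x : 'rV[R]_n) (t : R)
  : \bar R :=
  Rn_int (fun y => (heat_kernel (x - y) t * powR (enorm y) (- (2 * gamma)))%:E).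

Definition Psi (R : realType) (n : nat) (gamma : R) (x : 'rV[R]_n) (t : R) : R :=
  fine (Psi_ext gamma x t).

Fixpoint iterD (R : realType) (V : normedModType R) (vs : seq V) (f : V -> R)
  : V -> R :=
  match vs with
  | [::] => f
  | v :: vs' => 'D_v (iterD vs' f)
  end.

Definition smooth_on (R : realType) (V : normedModType R) (U : set V)
  (f : V -> R) : Prop :=
  forall (vs : seq V) (p : V), U p ->
    {for p, continuous (iterD vs f)} /\ (forall v : V, derivable (iterD vs f) p v).

Definition uncurry_xt (R : realType) (n : nat) (u : 'rV[R]_n -> R -> R)
  : 'rV[R]_n * R -> R := fun p => u p.1 p.2.

Definition dt (R : realType) (n : nat) (u : 'rV[R]_n -> R -> R) (x : 'rV[R]_n) (t : R) : R :=
  'D_((0 : 'rV[R]_n), (1 : R)) (uncurry_xt u) (x, t).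

Definition laplacian (R : realType) (n : nat) (u : 'rV[R]_n -> R -> R)
  (x : 'rV[R]_n) (t : R) : R :=
  \sum_(i < n)
    'D_((delta_mx ord0 i : 'rV[R]_n), (0 : R))
       ('D_((delta_mx ord0 i : 'rV[R]_n), (0 : R)) (uncurry_xt u)) (x, t).

(* Main.v *)
Require Import Defs.
From HB Require Import structures.
From mathcomp Require Import all_boot all_order all_algebra.
From mathcomp Require Import all_classical all_reals all_analysis.
From mathcomp Require Import measurable_realfun ring lra.
Set Implicit Arguments. Unset Strict Implicit. Unset Printing Implicit Defensive.
Import Order.TTheory GRing.Theory Num.Theory.
Import numFieldNormedType.Exports.
Local Open Scope classical_set_scope.
Local Open Scope ring_scope.

(** For a, b > 0 let K_a(z) be the integral over R of L^a (1 - L)^b exp (- z L),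
    where L(s) = e^s / (1 + e^s); up to a constant this is a Kummer function.
    The Gamma integral
      |y|^(-2g) = 1 / Gamma(g) * int_R exp(g r - e^r |y|^2) dr
    turns Psi, by Tonelli, into an integral of products of one-dimensional
    Gaussian integrals, which evaluates to
      Psi(x, t) = (4t)^(-g) / Gamma(g) * K_g(|x|^2 / (4t)),   b = n/2 - g.
    Self-similarity and the bounds on |x| < sqrt t are read off this formula.
    Since K_a' = - K_(a+1), the algebra generated by the coordinates x_i and the
    profiles t^alpha K_a(|x|^2 / (4t)) is stable under directional derivatives,
    so Psi is smooth. The heat equation reduces to the Kummer equation
      a K_a - (a + b + z) K_(a+1) + z K_(a+2) = 0.
    Finally K_a(z) <= C (1 + z)^(-a) gives Psi <= C' (4t + |x|^2)^(-g), and the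
    same Gamma trick computes the integral over R^n of (4t + |x|^2)^(-p), with
    p = g lam, as a multiple of t^(n/2 - p), where p - n/2 = 1 - eps/2 < 1. *)

(** * Integration *)

Section integral_general_measure.
Context d {T : measurableType d} {R : realType}.
Import HBNNSimple.
Variable mu : {measure set T -> \bar R}.
Variable D : set T.

(* Integrals of nonnegative functions are suprema of integrals of simple
   functions, so this holds for non-measurable f and g as well. *)
Lemma nneg_ae_le_integral (f g : T -> \bar R) :
  (forall x, D x -> 0 <= f x)%E -> (forall x, D x -> 0 <= g x)%E ->
  {ae mu, forall x, D x -> (f x <= g x)%E} ->
  (\int[mu]_(x in D) f x <= \int[mu]_(x in D) g x)%E.
Proof.
move=> f0 g0 [N [mN muN fgN]].
have fD0 x : (0 <= (f \_ D) x)%E by exact: erestrict_ge0.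
have gD0 x : (0 <= (g \_ D) x)%E by exact: erestrict_ge0.
rewrite integral_mkcond [leRHS]integral_mkcond [leLHS]ge0_integralTE//.
apply: ge_ereal_sup => _ /= [h hf <-].
have h0 x : [set: T] x -> (0 <= (h x)%:E)%E by rewrite lee_fin.
have mh : measurable_fun [set: T] (EFin \o h) by exact/measurable_EFinP.
rewrite -integralT_nnsfun (ge0_negligible_integral mN _ mh h0 muN)//.
have hN0 x : (0 <= ((EFin \o h) \_ ([set: T] `\` N)) x)%E.
  by apply: erestrict_ge0 => y _; exact: h0.
rewrite integral_mkcond [leLHS]ge0_integralTE// [leRHS]ge0_integralTE//.
apply: ereal_sup_le => _ [k kh <-]; exists k => // x; apply: le_trans (kh x) _.
rewrite patchE; case: ifPn => [/[!inE] -[_ Nx]|_]; last exact: gD0.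
apply: le_trans (hf x) _; rewrite !patchE; case: ifPn => // /[!inE] Dx.
by apply: contrapT => fg; apply/Nx/fgN => /(_ Dx).
Qed.

Lemma Rintegral_gt0 (f : T -> R) : measurable D -> mu D != 0%E ->
  mu.-integrable D (EFin \o f) -> (forall x, D x -> 0 < f x) ->
  0 < \int[mu]_(x in D) f x.
Proof.
move=> mD muD fi f0; rewrite lt_neqAle Rintegral_ge0 ?andbT; last first.
  by move=> x Dx; exact/ltW/f0.
apply: contraNneq muD => int0.
have : (\int[mu]_(x in D) `|(f x)%:E| = 0)%E.
  transitivity (\int[mu]_(x in D) f x)%:E; last by rewrite -int0.
  rewrite fineK; last exact: integrable_fin_num.
  by apply: eq_integral => x /[!inE] Dx; rewrite gee0_abs// lee_fin ltW// f0.
case/(ae_eq_integral_abs mu mD (measurable_int mu fi)) => N [mN muN fN].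
rewrite -measure_le0 -muN le_measure ?inE// => x Dx; apply: fN => /(_ Dx) [] fx.
by have := f0 x Dx; rewrite fx ltxx.
Qed.

Lemma integrable_EFinZ (k : R) (f : T -> R) : measurable D ->
  mu.-integrable D (EFin \o f) -> mu.-integrable D (EFin \o (fun x => k * f x)).
Proof.
by move=> mD fi; rewrite /comp; under eq_fun do rewrite EFinM; exact: integrableZl.
Qed.

Lemma integral_EFinZ (k : R) (f : T -> R) : measurable D ->
  mu.-integrable D (EFin \o f) ->
  (\int[mu]_(x in D) (k * f x)%:E = (k * \int[mu]_(x in D) f x)%:E)%E.
Proof.
move=> mD fi; under eq_integral do rewrite EFinM.
by rewrite integralZl// EFinM fineK//; exact: integrable_fin_num.
Qed.

Lemma le_integrable_scale (f g : T -> R) (k : R) : measurable D ->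
  measurable_fun D f -> (forall x, D x -> `|f x| <= k * g x) ->
  mu.-integrable D (EFin \o g) -> mu.-integrable D (EFin \o f).
Proof.
move=> mD mf fg /(integrable_EFinZ k mD); apply: le_integrable => //.
  exact/measurable_EFinP.
by move=> x Dx; rewrite /= lee_fin (le_trans (fg x Dx)) ?ler_norm.
Qed.

End integral_general_measure.

Section integral_real_line.
Context {R : realType}.
Notation mu := (@lebesgue_measure R).

Lemma lebesgue_measure_setT : mu [set: R] = +oo%E.
Proof. by rewrite -set_itvNyy lebesgue_measure_itv. Qed.

Lemma measurable_shift (a : R) : measurable_fun setT (shift a : R -> R).
Proof. exact: measurable_funD. Qed.

Lemma lebesgue_measure_shift (a : R) (A : set R) : measurable A ->
  pushforward mu (shift a : _ -> measurableTypeR R) A = mu A.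
Proof.
move=> mA; apply/esym/lebesgue_measure_unique => //.
  exact: measurable_shift.
move=> mshift _ [[x y]] _ <- /=.
rewrite /pushforward (_ : _ @^-1` _ = `]x - a, y - a]%classic).
  by rewrite !lebesgue_measure_itv/= !lte_fin ltrD2r -!EFinB opprB addrA subrK.
by apply/seteqP; split => z /=; rewrite !in_itv/= ltrBlDr lerBrDr.
Qed.

Lemma ge0_integral_shift (f : R -> \bar R) (a : R) :
  measurable_fun [set: R] f -> (forall x, 0 <= f x)%E ->
  (\int[mu]_x f (x + a)%R = \int[mu]_x f x)%E.
Proof.
move=> mf f0.
rewrite -[LHS](@ge0_integral_pushforward _ _ (measurableTypeR R) (measurableTypeR R)
  _ _ (measurable_shift a) mu _ _ measurableT mf)//.
apply: eq_measure_integral => [|mshift A mA _]; first exact: measurable_shift.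
exact: lebesgue_measure_shift.
Qed.

Lemma cvg_integral_symm_itv (f : R -> R) : mu.-integrable setT (EFin \o f) ->
  (\int[mu]_(x in `[(- n%:R)%R, n%:R%R]) (f x)%:E)%E @[n --> \oo] -->
  (\int[mu]_x (f x)%:E)%E.
Proof.
move=> fi; under eq_fun do rewrite integral_mkcond/=.
apply: (@dominated_cvg _ _ _ mu setT measurableT _ _ (abse \o (EFin \o f))) => //.
- move=> n; apply/(measurable_restrictT _ _).1 => //.
  by apply: measurable_funTS; exact: measurable_int fi.
- move=> x _; apply: cvg_near_cst; near=> n.
  rewrite patchE ifT// inE/= in_itv/= -ler_norml.
  by near: n; exact: nbhs_infty_ger.
- exact: integrable_abse.
- by move=> n x _; rewrite patchE; case: ifP => // _; rewrite abse0 abse_ge0.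
Unshelve. all: by end_near. Qed.

Lemma is_derive_continuous (f : R -> R) (x df : R) :
  is_derive x 1 f df -> {for x, continuous f}.
Proof. by move=> [dx _]; exact/differentiable_continuous/derivable1_diffP. Qed.

Lemma continuous_FTC2_is_derive (f F : R -> R) (a b : R) : a < b ->
  {in `[a, b], continuous f} ->
  {in `[a, b], forall x : R, is_derive x 1 F (f x)} ->
  (\int[mu]_(x in `[a, b]) (f x)%:E = (F b)%:E - (F a)%:E)%E.
Proof.
move=> ab cf dF; have itv_oo_cc x : x \in `]a, b[ -> x \in `[a, b].
  exact: subset_itv_oo_cc.
have cF x : x \in `[a, b] -> {for x, continuous F}.
  by move=> /dF; exact: is_derive_continuous.
apply: continuous_FTC2 => //.
- by apply: continuous_in_subspaceT => x /[!inE]; exact: cf.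
- split => [x /itv_oo_cc/dF[]//||].
  + by apply/cvg_at_right_filter/cF; rewrite in_itv/= lexx ltW.
  + by apply/cvg_at_left_filter/cF; rewrite in_itv/= lexx ltW.
- by move=> x /itv_oo_cc/dF[_]; rewrite derive1E.
Qed.

Lemma Rintegral_continuous_FTC2T (f F : R -> R) (l m : R) :
  continuous f -> mu.-integrable setT (EFin \o f) ->
  (forall x : R, is_derive x 1 F (f x)) ->
  F x @[x --> -oo] --> l -> F x @[x --> +oo] --> m ->
  \int[mu]_x f x = m - l.
Proof.
move=> cf fi dF Fl Fm.
suff cvgF : (\int[mu]_(x in `[(- n%:R)%R, n%:R%R]) (f x)%:E)%E @[n --> \oo] -->
    (m - l)%:E.
  by rewrite /Rintegral (cvg_unique _ (cvg_integral_symm_itv fi) cvgF).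
apply: (@cvg_trans _ (EFin (F n%:R - F (- n%:R)) @[n --> \oo])).
  apply: near_eq_cvg; near=> n.
  rewrite EFinB (@continuous_FTC2_is_derive f F)// gtrN// ltr0n.
  by near: n; exact: nbhs_infty_gt.
apply: cvg_EFin; first exact: nearW.
apply: cvgB; first exact: cvg_comp cvgr_idn Fm.
by move/cvgNy_compNP : Fl; exact: cvg_comp cvgr_idn.
Unshelve. all: by end_near. Qed.

Lemma ge0_continuous_FTC2_oc (f F : R -> R) (a b : R) :
  {in `]a, b], forall x, 0 <= f x} -> {in `]a, b], continuous f} ->
  {in `]a, b], forall x : R, is_derive x 1 F (f x)} ->
  F x @[x --> a^'+] --> F a -> a < b ->
  (\int[mu]_(x in `]a, b]) (f x)%:E = (F b)%:E - (F a)%:E)%E.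
Proof.
move=> f0 cf dF Fa ab.
pose u (n : nat) := a + n.+1%:R^-1; pose I n := `[u n, b]%classic.
have u_gt n : a < u n by rewrite ltrDl.
have u_cvg : u n @[n --> \oo] --> a.
  rewrite -[X in _ --> X]addr0; apply: cvgD; first exact: cvg_cst.
  exact: cvg_harmonic.
have sub n : {subset `[u n, b] <= `]a, b]} by apply: subitvPl; rewrite bnd_simp.
have ndI : nondecreasing_seq I.
  move=> m n mn; apply/subsetPset/subset_itvr.
  by rewrite bnd_simp lerD2l lef_pV2 ?posrE// ler_nat.
have intI : (\int[mu]_(x in I n) (f x)%:E)%E @[n --> \oo] -->
    (\int[mu]_(x in \bigcup_n I n) (f x)%:E)%E.
  apply: ge0_nondecreasing_set_cvg_integral => // [n|n|n x xI].
  - exact: measurable_itv.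
  - apply/measurable_EFinP; apply: subspace_continuous_measurable_fun.
      exact: measurable_itv.
    by apply: continuous_in_subspaceT => x /[!inE] /sub; exact: cf.
  - by rewrite lee_fin f0//; exact: (sub n).
rewrite itv_open_bnd_bigcup; apply: (cvg_unique _ intI) => //.
apply: (@cvg_trans _ (EFin (F b - F (u n)) @[n --> \oo])).
  apply: near_eq_cvg; near=> n; rewrite EFinB (@continuous_FTC2_is_derive f F)//.
  - by near: n; exact: (cvgr_lt a).
  - by move=> x /sub; exact: cf.
  - by move=> x /sub; exact: dF.
apply: cvg_EFin; first exact: nearW.
apply: cvgB; first exact: cvg_cst.
by move/cvg_at_rightP : Fa; exact.
Unshelve. all: by end_near. Qed.

Lemma integral_powRN_lty (k T : R) : k < 1 -> 0 < T ->
  (\int[mu]_(t in `]0%R, T]) (powR t (- k))%:E < +oo)%E.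
Proof.
move=> k1 T0; have k1' : 0 < 1 - k by rewrite subr_gt0.
rewrite (@ge0_continuous_FTC2_oc _ (fun t => (1 - k)^-1 * powR t (1 - k))) ?ltry//.
- by move=> t _; rewrite powR_ge0.
- move=> t; rewrite in_itv/= => /andP[t0 _].
  exact: is_derive_continuous (is_derive1_powR (- k) t0).
- move=> t; rewrite in_itv/= => /andP[t0 _].
  apply: is_derive_eq (is_deriveZ (1 - k)^-1 (is_derive1_powR (1 - k) t0)) _.
  by rewrite /GRing.scale/= mulKf ?gt_eqF//; congr powR; ring.
- rewrite powR0 ?gt_eqF// mulr0 -[X in _ --> X](mulr0 (1 - k)^-1).
  by apply: cvgM; [exact: cvg_cst|exact: powR_cvg0].
Qed.

End integral_real_line.

(** * Exponential weights and the logistic function *)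

Section exponential_bounds.
Context {R : realType}.
Notation mu := (@lebesgue_measure R).

Lemma cvgy_expRNM (c : R) : 0 < c -> expR (- (c * s)) @[s --> +oo] --> (0 : R).
Proof.
move=> c0; have := @cvgr_expR R.
by apply: (@cvg_comp _ _ _ ( *%R c) (fun s => expR (- s)) _ (pinfty_nbhs R));
  exact: gt0_cvgMry.
Qed.

(* The maximum of y ^ p * exp (- y) is attained at y = p. *)
Lemma expRN_le_powR (p y : R) : 0 < p -> 0 < y ->
  expR (- y) <= powR p p * powR y (- p).
Proof.
move=> p0 y0; rewrite /powR !gt_eqF// -expRD ler_expR.
have := expR_ge1Dx (ln (y / p)); rewrite lnK ?posrE ?divr_gt0// ln_div ?posrE//.
by rewrite ler_pdivlMr//; lra.
Qed.

Lemma integrable_expRN_norm (c : R) : 0 < c ->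
  mu.-integrable setT (EFin \o (fun s => expR (- (c * `|s|)))).
Proof.
move=> c0.
have cexp : continuous (fun s : R => expR (- (c * `|s|))).
  move=> s; apply: continuous_comp; last exact: continuous_expR.
  by apply: cvgN; apply: cvgM; [exact: cvg_cst|exact: norm_continuous].
apply/integrableP; split.
  by apply/measurable_EFinP; exact: continuous_measurable_fun.
under eq_integral do rewrite /= ger0_norm ?expR_ge0//.
rewrite ge0_symfun_integralT => [|s||s]; rewrite /= ?expR_ge0 ?normrN//.
apply: lte_mul_pinfty => //; rewrite -set_itvcy.
have : mu.-integrable `[0, +oo[ (fun s => c^-1%:E * (exponential_pdf c s)%:E)%E.
  apply: integrableZl => //.
  by apply: integrableS (integrable_exponential_pdf c0).
move/integrableP => [_]; apply: le_lt_trans; rewrite le_eqVlt; apply/predU1P; left.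
apply: eq_integral => s; rewrite inE/= in_itv/= andbT => s0.
rewrite /= exponential_pdfE// mulrA mulVf ?gt_eqF// mul1r mulNr.
by rewrite !ger0_norm ?expR_ge0.
Qed.

Lemma integrable_le_expR (f : R -> R) (a b k l : R) : 0 < a -> 0 < b ->
  measurable_fun setT f ->
  (forall s, `|f s| <= k * expR (a * s)) ->
  (forall s, `|f s| <= l * expR (- (b * s))) ->
  mu.-integrable setT (EFin \o f).
Proof.
move=> a0 b0 mf fa fb; pose c := Num.min a b.
have c0 : 0 < c by rewrite lt_min a0.
apply: (le_integrable_scale (k := Num.max k l) _ _ _ (integrable_expRN_norm c0)) => //.
have k0 : 0 <= k by have := le_trans (normr_ge0 _) (fa 0); rewrite mulr0 expR0 mulr1.
have l0 : 0 <= l.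
  by have := le_trans (normr_ge0 _) (fb 0); rewrite mulr0 oppr0 expR0 mulr1.
move=> s _; have [s0|s0] := leP 0 s.
  apply: (le_trans (fb s)); rewrite ler_pM ?expR_ge0 ?le_max ?lexx ?orbT//.
  by rewrite ler_expR lerN2 ger0_norm// ler_wpM2r// ge_min lexx orbT.
apply: (le_trans (fa s)); rewrite ler_pM ?expR_ge0 ?le_max ?lexx//.
by rewrite ler_expR ltr0_norm// mulrN opprK ler_wnM2r ?ge_min ?lexx// ltW.
Qed.

End exponential_bounds.

Section logistic_function.
Context {R : realType}.
Implicit Types s : R.

Definition logistic s : R := expR s / (1 + expR s).

Lemma expR1D_gt0 s : 0 < 1 + expR s.
Proof. by rewrite addr_gt0 ?expR_gt0. Qed.

Lemma logistic_gt0 s : 0 < logistic s.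
Proof. by rewrite divr_gt0 ?expR_gt0 ?expR1D_gt0. Qed.

Lemma logisticN s : logistic (- s) = 1 - logistic s.
Proof.
rewrite /logistic expRN; have := expR_gt0 s; move: (expR s) => e e0.
by field; rewrite !gt_eqF ?addr_gt0.
Qed.

Lemma onem_logisticE s : 1 - logistic s = (1 + expR s)^-1.
Proof. by rewrite /logistic; field; rewrite gt_eqF ?expR1D_gt0. Qed.

Lemma onem_logistic_gt0 s : 0 < 1 - logistic s.
Proof. by rewrite -logisticN logistic_gt0. Qed.

Lemma logistic_lt1 s : logistic s < 1.
Proof. by rewrite -subr_gt0 onem_logistic_gt0. Qed.

Lemma logistic_ge_half s : 0 <= s -> 2^-1 <= logistic s.
Proof.
by rewrite -ler_expR expR0 ler_pdivlMr ?expR1D_gt0//; lra.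
Qed.

Lemma logistic_ge_half_expR s : s <= 0 -> expR s / 2 <= logistic s.
Proof.
rewrite -ler_expR expR0 => s0; rewrite ler_pM2l ?expR_gt0//.
by rewrite lef_pV2 ?posrE ?expR1D_gt0//; lra.
Qed.

Lemma is_derive_logistic s : is_derive s 1 logistic (logistic s * (1 - logistic s)).
Proof.
have e0 : (cst 1 + expR) s != 0 by rewrite gt_eqF ?expR1D_gt0.
have dD := is_deriveD (is_derive_cst (1 : R) s 1) (is_derive_expR s).
apply: (is_derive_eq (is_deriveM (is_derive_expR s) (is_deriveV e0 dD))).
rewrite /logistic /GRing.scale /= !fctE /=; move: e0; rewrite !fctE /= => e0.
by field.
Qed.

End logistic_function.

(** * Euler's Gamma integral and Kummer's function *)

Section gamma_integral.
Context {R : realType}.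
Notation mu := (@lebesgue_measure R).
Implicit Types p A s : R.

Definition gamma_integrand p A s : R := expR (p * s - A * expR s).

(* Euler's integral after the substitution t = expR s. *)
Definition euler_gamma p : R := \int[mu]_s gamma_integrand p 1 s.

Lemma continuous_gamma_integrand p A : continuous (gamma_integrand p A).
Proof.
move=> s; apply: continuous_comp; last exact: continuous_expR.
apply: cvgB; apply: cvgM; do ?exact: cvg_cst; first exact: cvg_id.
exact: continuous_expR.
Qed.

Lemma measurable_gamma_integrand p A (D : set R) :
  measurable_fun D (gamma_integrand p A).
Proof.
by apply: measurable_funTS; apply: continuous_measurable_fun;
  exact: continuous_gamma_integrand.
Qed.

Lemma gamma_integrand_shift p A s : 0 < A ->
  gamma_integrand p A s = powR A (- p) * gamma_integrand p 1 (s + ln A).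
Proof.
move=> A0; rewrite /gamma_integrand /powR gt_eqF// -expRD; congr expR.
by rewrite expRD lnK ?posrE//; ring.
Qed.

Lemma integrable_gamma_integrand p A : 0 < p -> 0 < A ->
  mu.-integrable setT (EFin \o gamma_integrand p A).
Proof.
move=> p0 A0; have p1 : 0 < p + 1 by rewrite addr_gt0.
pose k := powR (p + 1) (p + 1) * powR A (- (p + 1)).
apply: (@integrable_le_expR _ _ p 1 1 k) => // [|s|s].
- exact: measurable_gamma_integrand.
- by rewrite ger0_norm ?expR_ge0// mul1r ler_expR gerBl mulr_ge0 ?expR_ge0// ltW.
- rewrite ger0_norm ?expR_ge0// /gamma_integrand mul1r expRD mulrC.
  apply: (@le_trans _ _
    (powR (p + 1) (p + 1) * powR (A * expR s) (- (p + 1)) * expR (p * s))).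
    by rewrite ler_pM2r ?expR_gt0// expRN_le_powR// mulr_gt0 ?expR_gt0.
  rewrite powRM ?expR_ge0 ?(ltW A0)// mulrA -expRM -[leLHS]mulrA -expRD.
  by rewrite le_eqVlt; apply/predU1P; left; congr (_ * expR _); ring.
Qed.

Lemma euler_gamma_gt0 p : 0 < p -> 0 < euler_gamma p.
Proof.
move=> p0; apply: Rintegral_gt0 => //.
- by rewrite [X in X != _]lebesgue_measure_setT.
- exact: integrable_gamma_integrand.
- by move=> s _; exact: expR_gt0.
Qed.

Lemma integral_gamma_integrand p A : 0 < p -> 0 < A ->
  (\int[mu]_s (gamma_integrand p A s)%:E = (euler_gamma p * powR A (- p))%:E)%E.
Proof.
move=> p0 A0; under eq_integral do rewrite gamma_integrand_shift// EFinM.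
rewrite (@ge0_integral_shift _
  (fun s => (powR A (- p))%:E * (gamma_integrand p 1 s)%:E)%E (ln A)).
- under eq_integral do rewrite -EFinM.
  rewrite integral_EFinZ//; last exact: integrable_gamma_integrand.
  by rewrite /euler_gamma mulrC.
- apply: emeasurable_funM => //.
  by apply/measurable_EFinP; exact: measurable_gamma_integrand.
- by move=> s; rewrite mule_ge0// lee_fin ?powR_ge0 ?expR_ge0.
Qed.

End gamma_integral.

Section beta_weight.
Context {R : realType}.
Implicit Types a b s : R.

(* The density of Euler's Beta integral after the substitution t = logistic s. *)
Definition beta_weight a b s : R := powR (logistic s) a * powR (1 - logistic s) b.

Lemma beta_weight_gt0 a b s : 0 < beta_weight a b s.
Proof. by rewrite mulr_gt0 ?powR_gt0 ?logistic_gt0 ?onem_logistic_gt0. Qed.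

Lemma beta_weightN a b s : beta_weight a b (- s) = beta_weight b a s.
Proof. by rewrite /beta_weight logisticN subKr mulrC. Qed.

Lemma beta_weight_succ a b s :
  beta_weight (a + 1) b s = logistic s * beta_weight a b s.
Proof.
rewrite /beta_weight powRD; last by rewrite (gt_eqF (logistic_gt0 s)) implybT.
by rewrite powRr1 ?ltW ?logistic_gt0//; ring.
Qed.

Lemma beta_weightE a b s :
  beta_weight a b s = expR (a * s) * powR (1 + expR s) (- (a + b)).
Proof.
have e1 := expR1D_gt0 s; have e0 := expR_gt0 s.
rewrite /beta_weight onem_logisticE /logistic /powR !gt_eqF ?divr_gt0 ?invr_gt0//.
rewrite ln_div ?posrE// expRK lnV ?posrE// -!expRD; congr expR.
by ring.
Qed.

Lemma beta_weight_le_expR a b s : 0 <= a -> 0 <= b ->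
  beta_weight a b s <= expR (a * s).
Proof.
move=> a0 b0; rewrite beta_weightE ler_piMr ?expR_ge0// powRN invf_le1.
  by rewrite -[leLHS](powRr0 (1 + expR s)) ler_powR ?lerDl ?expR_ge0 ?addr_ge0.
by rewrite powR_gt0 ?expR1D_gt0.
Qed.

Lemma beta_weight_le_expRN a b s : 0 <= a -> 0 <= b ->
  beta_weight a b s <= expR (- (b * s)).
Proof. by move=> a0 b0; rewrite -beta_weightN -mulrN beta_weight_le_expR. Qed.

Lemma is_derive_beta_weight a b s : is_derive s 1 (beta_weight a b)
  (a * beta_weight a b s - (a + b) * beta_weight (a + 1) b s).
Proof.
have L0 := logistic_gt0 s; have M0 := onem_logistic_gt0 s.
have dL := is_derive_logistic s.
have dM := is_deriveB (is_derive_cst (1 : R) s 1) dL.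
have dLa := @is_derive1_comp _ (@powR R ^~ a) logistic s _ _ (is_derive1_powR a L0) dL.
have dMb := @is_derive1_comp _ (@powR R ^~ b) (cst 1 - logistic) s _ _
  (is_derive1_powR b M0) dM.
apply: (is_derive_eq (is_deriveM dLa dMb)).
rewrite beta_weight_succ /beta_weight /GRing.scale /= !fctE /=.
rewrite !powRB ?(gt_eqF L0) ?(gt_eqF M0) ?implybT// !powRr1 ?ltW//.
by field; rewrite !gt_eqF.
Qed.

End beta_weight.

Section kummer_function.
Context {R : realType}.
Notation mu := (@lebesgue_measure R).
Implicit Types a b z s : R.

Definition kummer_integrand a b z s : R :=
  beta_weight a b s * expR (- (z * logistic s)).

(* B(a, b) times Kummer's function M(a, a + b, - z), by Euler's integral
   representation after the substitution t = logistic s. *)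
Definition kummer a b z : R := \int[mu]_s kummer_integrand a b z s.

Lemma kummer_integrand_gt0 a b z s : 0 < kummer_integrand a b z s.
Proof. by rewrite mulr_gt0 ?beta_weight_gt0 ?expR_gt0. Qed.

Lemma kummer_integrand_succ a b z s :
  kummer_integrand (a + 1) b z s = logistic s * kummer_integrand a b z s.
Proof. by rewrite /kummer_integrand beta_weight_succ mulrA. Qed.

Lemma kummer_integrand_le_beta_weight a b z M s : `|z| <= M ->
  kummer_integrand a b z s <= expR M * beta_weight a b s.
Proof.
move=> zM; rewrite mulrC ler_pM2l ?beta_weight_gt0// ler_expR.
rewrite (le_trans (ler_norm _))// normrN normrM (le_trans _ zM)//.
by rewrite ler_piMr// gtr0_norm ?logistic_gt0// ltW ?logistic_lt1.
Qed.

Lemma is_derive_kummer_integrand_param a b z s :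
  is_derive z 1 (kummer_integrand a b ^~ s) (- kummer_integrand (a + 1) b z s).
Proof.
have d := is_derive1_comp (is_derive_expR (- logistic s * z))
  (is_deriveZ (- logistic s) (is_derive_id z 1)).
have -> : kummer_integrand a b ^~ s =
    beta_weight a b s *: (expR \o *%R (- logistic s)).
  apply/funext => x; rewrite /kummer_integrand /GRing.scale/= /GRing.scale/=.
  by rewrite mulNr (mulrC x).
apply: (is_derive_eq (is_deriveZ _ d)).
rewrite kummer_integrand_succ /kummer_integrand /GRing.scale/= mulr1 !mulNr (mulrC z).
by ring.
Qed.

Lemma is_derive_kummer_integrand a b z s : is_derive s 1 (kummer_integrand a b z)
  (a * kummer_integrand a b z s - (a + b + z) * kummer_integrand (a + 1) b z s
   + z * kummer_integrand (a + 2) b z s).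
Proof.
have d := @is_derive1_comp _ expR (- z *: logistic) s _ _
  (is_derive_expR (- z * logistic s)) (is_deriveZ (- z) (is_derive_logistic s)).
have kE : kummer_integrand a b z = beta_weight a b * (expR \o (- z *: logistic)).
  by apply/funext => x; rewrite /kummer_integrand -mulNr.
rewrite [X in is_derive _ _ X _]kE.
apply: (is_derive_eq (is_deriveM (is_derive_beta_weight a b s) d)).
rewrite (_ : a + 2 = a + 1 + 1); last by ring.
rewrite /kummer_integrand !beta_weight_succ /GRing.scale/= /GRing.scale/= !mulNr.
by ring.
Qed.

Lemma continuous_kummer_integrand a b z : continuous (kummer_integrand a b z).
Proof.
by move=> s; exact: is_derive_continuous (is_derive_kummer_integrand a b z s).
Qed.

Lemma kummer_integrand0 a b : kummer_integrand a b 0 = beta_weight a b.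
Proof. by apply/funext => s; rewrite /kummer_integrand mul0r oppr0 expR0 mulr1. Qed.

Lemma integrable_kummer_integrand a b z : 0 < a -> 0 < b ->
  mu.-integrable setT (EFin \o kummer_integrand a b z).
Proof.
move=> a0 b0.
have le_expR_weight c s : beta_weight a b s <= c ->
    `|kummer_integrand a b z s| <= expR `|z| * c.
  move=> wc; rewrite gtr0_norm ?kummer_integrand_gt0//.
  apply: le_trans (kummer_integrand_le_beta_weight a b s (lexx `|z|)) _.
  by rewrite ler_pM2l ?expR_gt0.
apply: (@integrable_le_expR _ _ a b (expR `|z|) (expR `|z|)) => // [|s|s].
- by apply: continuous_measurable_fun; exact: continuous_kummer_integrand.
- by apply: le_expR_weight; rewrite beta_weight_le_expR ?ltW.
- by apply: le_expR_weight; rewrite beta_weight_le_expRN ?ltW.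
Qed.

Lemma kummer_gt0 a b z : 0 < a -> 0 < b -> 0 < kummer a b z.
Proof.
move=> a0 b0; apply: Rintegral_gt0 => //.
- by rewrite [X in X != _]lebesgue_measure_setT.
- exact: integrable_kummer_integrand.
- by move=> s _; exact: kummer_integrand_gt0.
Qed.

Lemma kummer_nonincreasing a b : 0 < a -> 0 < b ->
  {homo kummer a b : z1 z2 /~ z1 <= z2}.
Proof.
move=> a0 b0 z1 z2 z21.
apply: le_Rintegral => //; do ?exact: integrable_kummer_integrand.
move=> s _; rewrite ler_pM2l ?beta_weight_gt0// ler_expR lerN2.
by rewrite ler_wpM2r// ltW ?logistic_gt0.
Qed.

Lemma is_derive_kummer a b z : 0 < a -> 0 < b ->
  is_derive z 1 (kummer a b) (- kummer (a + 1) b z).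
Proof.
move=> a0 b0; have a1 : 0 < a + 1 by rewrite addr_gt0.
pose I : set R := `]z - 1, z + 1[%classic.
have zI : I z by rewrite /I/= in_itv/= !ltrBlDr !ltrDl ltr01.
have dk (x s : R) : is_derive x 1 (kummer_integrand a b ^~ s)
    (- kummer_integrand (a + 1) b x s).
  exact: is_derive_kummer_integrand_param.
have partialE (x s : R) :
    partial1of2 (kummer_integrand a b) x s = - kummer_integrand (a + 1) b x s.
  by rewrite partial1of2E; case: (dk x s).
have int_k x : I x -> mu.-integrable setT (EFin \o kummer_integrand a b x).
  by move=> _; exact: integrable_kummer_integrand.
have der_k (x s : R) : I x -> setT s -> derivable (kummer_integrand a b ^~ s) x 1.
  by move=> _ _; case: (dk x s).
pose G s := expR (`|z| + 1) * beta_weight (a + 1) b s.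
have G0 s : 0 <= G s by rewrite mulr_ge0 ?expR_ge0 ?ltW ?beta_weight_gt0.
have int_G : mu.-integrable setT (EFin \o G).
  rewrite /G -kummer_integrand0; apply: integrable_EFinZ => //.
  exact: integrable_kummer_integrand.
have partial_le (x s : R) : I x -> setT s ->
    `|partial1of2 (kummer_integrand a b) x s| <= G s.
  rewrite /I/= in_itv/= => /andP[zx xz] _.
  rewrite partialE normrN gtr0_norm ?kummer_integrand_gt0//.
  apply: kummer_integrand_le_beta_weight; rewrite ler_norml.
  by have := ler_norm z; have := ler_norm (- z); rewrite normrN; lra.
apply: DeriveDef.
  exact: derivable_under_integral zI int_k der_k G G0 int_G partial_le.
rewrite -derive1E.
rewrite [LHS](differentiation_under_integral measurableT zI int_k der_k G0 int_G)//.
under eq_Rintegral do rewrite partialE -mulN1r.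
by rewrite RintegralZl ?mulN1r//; exact: integrable_kummer_integrand.
Qed.

Lemma cvgy_kummer_integrand a b z : 0 <= a -> 0 < b ->
  kummer_integrand a b z s @[s --> +oo] --> 0.
Proof.
move=> a0 b0.
apply: (@squeeze_cvgr _ _ _ _ (cst 0) (fun s => expR `|z| * expR (- (b * s)))).
- apply: nearW => s /=; rewrite ltW ?kummer_integrand_gt0//=.
  apply: le_trans (kummer_integrand_le_beta_weight a b s (lexx `|z|)) _.
  by rewrite ler_pM2l ?expR_gt0// beta_weight_le_expRN// ltW.
- exact: cvg_cst.
- rewrite -[X in _ --> X](mulr0 (expR `|z|)).
  by apply: cvgM; [exact: cvg_cst|exact: cvgy_expRNM].
Qed.

Lemma kummer_integrandN a b z s :
  kummer_integrand a b z (- s) = expR (- z) * kummer_integrand b a (- z) s.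
Proof.
rewrite /kummer_integrand beta_weightN logisticN mulrCA -expRD.
by congr (_ * expR _); ring.
Qed.

Lemma cvgNy_kummer_integrand a b z : 0 < a -> 0 <= b ->
  kummer_integrand a b z s @[s --> -oo] --> 0.
Proof.
move=> a0 b0; apply/cvgNy_compNP.
have -> : kummer_integrand a b z \o -%R =
    (fun s => expR (- z) * kummer_integrand b a (- z) s).
  by apply/funext => s; exact: kummer_integrandN.
have := cvgM (cvg_cst (expR (- z))) (cvgy_kummer_integrand (- z) b0 a0).
by rewrite mulr0; apply.
Qed.

Lemma kummer_integrand_shift a b N A s : 0 < A ->
  kummer_integrand a b (N / A) (s + ln A) =
  powR A a * (expR (a * s) * (powR (1 + A * expR s) (- (a + b)) *
    expR (- (expR s * N / (1 + A * expR s))))).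
Proof.
move=> A0; have e0 : 0 < 1 + A * expR s.
  by rewrite ltr_wpDr// mulr_ge0 ?expR_ge0// ltW.
rewrite /kummer_integrand beta_weightE /logistic expRD lnK ?posrE// (mulrC (expR s)).
have -> : powR A a = expR (a * ln A) by rewrite /powR gt_eqF.
rewrite mulrDr expRD mulrA (mulrC (expR _) (expR _)) -!mulrA.
by congr (_ * (_ * (_ * expR _))); field; rewrite !gt_eqF.
Qed.

(* The left-hand side is the integral over the line of the derivative in s of
   kummer_integrand a b z. *)
Lemma kummer_ode a b z : 0 < a -> 0 < b ->
  a * kummer a b z - (a + b + z) * kummer (a + 1) b z + z * kummer (a + 2) b z = 0.
Proof.
move=> a0 b0; have a1 : 0 < a + 1 by rewrite addr_gt0.
have a2 : 0 < a + 2 by rewrite addr_gt0.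
pose K (c : R) := kummer_integrand c b z.
have intK (c k : R) : 0 < c -> mu.-integrable setT (EFin \o (fun s => k * K c s)).
  move=> c0; apply: integrable_EFinZ => //.
  exact: integrable_kummer_integrand.
have int_diff : mu.-integrable setT
    (EFin \o (fun s => a * K a s - (a + b + z) * K (a + 1) s)).
  rewrite /comp; under eq_fun do rewrite EFinB.
  by apply: integrableB => //; exact: intK.
have int_sum : mu.-integrable setT
    (EFin \o (fun s => a * K a s - (a + b + z) * K (a + 1) s + z * K (a + 2) s)).
  rewrite /comp; under eq_fun do rewrite EFinD.
  by apply: integrableD => //; exact: intK.
rewrite /kummer -!RintegralZl//; do ?exact: integrable_kummer_integrand.
rewrite -RintegralB//; [|exact: intK|exact: intK].
rewrite -RintegralD//; last exact: intK.
rewrite (Rintegral_continuous_FTC2T _ _ (is_derive_kummer_integrand a b z)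
  (cvgNy_kummer_integrand _ _ _) (cvgy_kummer_integrand _ _ _)) ?subrr ?ltW//.
move=> s; apply: cvgD; [apply: cvgB|]; apply: cvgM;
  do ?exact: cvg_cst; exact: continuous_kummer_integrand.
Qed.

Lemma kummer_integrand_le_gamma a b z s : 0 <= a -> 0 <= b -> 0 <= z ->
  kummer_integrand a b z s <=
  gamma_integrand a (z / 2) s + expR (- (z / 2)) * beta_weight a b s.
Proof.
move=> a0 b0 z0; have w0 := beta_weight_gt0 a b s.
have [s0|/ltW s0] := leP 0 s.
  rewrite ler_wpDl ?expR_ge0// /kummer_integrand mulrC ler_pM2r// ler_expR lerN2.
  by rewrite ler_wpM2l// logistic_ge_half.
rewrite ler_wpDr ?(mulr_ge0 (expR_ge0 _) (ltW w0))// /gamma_integrand expRD.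
rewrite ler_pM ?expR_ge0 ?(ltW w0) ?beta_weight_le_expR// ler_expR lerN2.
by rewrite -mulrA ler_wpM2l// mulrC logistic_ge_half_expR.
Qed.

Lemma kummer_le_gamma a b z : 0 < a -> 0 < b -> 0 < z -> kummer a b z <=
  euler_gamma a * powR (z / 2) (- a) + expR (- (z / 2)) * kummer a b 0.
Proof.
move=> a0 b0 z0; have z2 : 0 < z / 2 by rewrite divr_gt0.
have int_k z' : mu.-integrable setT (EFin \o kummer_integrand a b z').
  exact: integrable_kummer_integrand.
rewrite -lee_fin {1}/kummer /Rintegral fineK; last first.
  exact: (integrable_fin_num _ (int_k z)).
apply: (@le_trans _ _ (\int[mu]_s ((gamma_integrand a (z / 2) s)%:E +
    (expR (- (z / 2)) * kummer_integrand a b 0 s)%:E))%E).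
  apply: nneg_ae_le_integral => [s _|s _|].
  - by rewrite lee_fin ltW ?kummer_integrand_gt0.
  - rewrite -EFinD lee_fin addr_ge0 ?expR_ge0// mulr_ge0 ?expR_ge0//.
    by rewrite ltW ?kummer_integrand_gt0.
  - apply: aeW => s _; rewrite -EFinD lee_fin kummer_integrand0.
    by rewrite kummer_integrand_le_gamma// ltW.
rewrite ge0_integralD//=; last 4 first.
- by move=> s _; rewrite lee_fin expR_ge0.
- by apply/measurable_EFinP; exact: measurable_gamma_integrand.
- by move=> s _; rewrite lee_fin mulr_ge0 ?expR_ge0// ltW ?kummer_integrand_gt0.
- apply/measurable_EFinP; apply: measurable_funM => //.
  by apply: continuous_measurable_fun; exact: continuous_kummer_integrand.
by rewrite integral_gamma_integrand// integral_EFinZ.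
Qed.

Lemma kummer_le_shift a b z : 0 < a -> 0 < b ->
  kummer a b z <= expR 1 * kummer a b (1 + z).
Proof.
move=> a0 b0; rewrite -RintegralZl//; last exact: integrable_kummer_integrand.
apply: le_Rintegral => //; first exact: integrable_kummer_integrand.
  by apply: integrable_EFinZ => //; exact: integrable_kummer_integrand.
move=> s _; rewrite mulrCA ler_pM2l ?beta_weight_gt0// -expRD ler_expR.
by have := logistic_lt1 s; rewrite mulrDl mul1r; lra.
Qed.

Lemma kummer_le_powR a b : 0 < a -> 0 < b ->
  exists2 C, 0 < C & forall z, 0 <= z -> kummer a b z <= C * powR (1 + z) (- a).
Proof.
move=> a0 b0; have G0 := euler_gamma_gt0 a0; have K0 := kummer_gt0 0 a0 b0.
pose C := expR 1 * (euler_gamma a + powR a a * kummer a b 0) * powR 2 a.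
exists C => [|z z0].
  by rewrite !mulr_gt0 ?expR_gt0 ?powR_gt0// addr_gt0 ?mulr_gt0 ?powR_gt0.
have z1 : 0 < 1 + z by rewrite ltr_wpDr.
have z2 : 0 < (1 + z) / 2 by rewrite divr_gt0.
apply: (le_trans (kummer_le_shift z a0 b0)).
apply: (@le_trans _ _ (expR 1 *
  ((euler_gamma a + powR a a * kummer a b 0) * powR ((1 + z) / 2) (- a)))).
  rewrite ler_pM2l ?expR_gt0// (le_trans (kummer_le_gamma a0 b0 z1))//.
  by rewrite [leRHS]mulrDl lerD2l mulrAC ler_pM2r// expRN_le_powR.
rewrite powRM ?(ltW z1)// -powR_inv1// -powRrM mulrNN mul1r.
by rewrite le_eqVlt /C; apply/predU1P; left; ring.
Qed.

End kummer_function.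

(** * Euclidean norm and iterated integrals *)

Section euclidean_norm.
Context {R : realType} {n : nat}.
Implicit Types x y : 'rV[R]_n.

Lemma enorm_sqr x : enorm x ^+ 2 = \sum_(i < n) x ord0 i ^+ 2.
Proof. by rewrite sqr_sqrtr// sumr_ge0// => i _; exact: sqr_ge0. Qed.

Lemma enorm0 : enorm (0 : 'rV[R]_n) = 0.
Proof. by rewrite /enorm big1 ?sqrtr0// => i _; rewrite mxE expr0n. Qed.

Lemma enorm_gt0 x : (0 < enorm x) = (x != 0).
Proof.
rewrite sqrtr_gt0; apply/idP/idP => [|/eqP x0].
  by apply: contraTneq => ->; rewrite big1 ?ltxx// => i _; rewrite mxE expr0n.
rewrite lt_neqAle sumr_ge0 ?andbT => [|i _]; last exact: sqr_ge0.
apply/eqP => /esym/psumr_eq0P sum0; apply: x0; apply/rowP => i; rewrite mxE.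
by apply/eqP; rewrite -sqrf_eq0 sum0// => j _; exact: sqr_ge0.
Qed.

Definition dot x y : R := \sum_(i < n) x ord0 i * y ord0 i.

Lemma dotx0 x : dot x 0 = 0.
Proof. by rewrite /dot big1// => i _; rewrite mxE mulr0. Qed.

Lemma dot_delta_mx x i : dot x (delta_mx ord0 i) = x ord0 i.
Proof.
rewrite /dot (bigD1 i)//= big1 => [|j ji]; first by rewrite mxE !eqxx mulr1 addr0.
by rewrite mxE eqxx (negbTE ji) mulr0.
Qed.

End euclidean_norm.

Section iterated_integrals.
Context {R : realType}.
Notation mu := (@lebesgue_measure R).
Implicit Types (k n : nat) (c : nat -> R).

Lemma iter_int_ge0 k (F : (nat -> R) -> \bar R) :
  (forall c, 0 <= F c)%E -> (0 <= iter_int k F)%E.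
Proof.
elim: k F => [|k IHk] F F0 /=; first exact: F0.
by apply: integral_ge0 => s _; exact: IHk.
Qed.

Lemma le_iter_int k (F G : (nat -> R) -> \bar R) : (forall c, 0 <= F c)%E ->
  (forall c, F c <= G c)%E -> (iter_int k F <= iter_int k G)%E.
Proof.
elim: k F G => [|k IHk] F G F0 FG /=; first exact: FG.
apply: nneg_ae_le_integral => [s _|s _|].
- exact: iter_int_ge0.
- by apply: iter_int_ge0 => c; exact: le_trans (FG _).
- by apply: aeW => s _; exact: IHk.
Qed.

Lemma eq_iter_int k (F G : (nat -> R) -> \bar R) :
  F =1 G -> iter_int k F = iter_int k G.
Proof. by move=> /funext ->. Qed.

Lemma le_iter_int_off_hyperplane k (F G : (nat -> R) -> \bar R) :
  (forall c, 0 <= F c)%E -> (forall c, 0 <= G c)%E ->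
  (forall c, c k != 0 -> (F c <= G c)%E) -> (iter_int k.+1 F <= iter_int k.+1 G)%E.
Proof.
move=> F0 G0 FG; apply: nneg_ae_le_integral => [s _|s _|]; do ?exact: iter_int_ge0.
exists [set 0]; split; [exact: measurable_set1|exact: lebesgue_measure_set1|].
move=> s /= /not_implyP[_]; apply: contra_notP => /eqP s0.
by apply: le_iter_int => // c; apply: FG; rewrite eqxx.
Qed.

Lemma eq_iter_int_off_hyperplane k (F G : (nat -> R) -> \bar R) :
  (forall c, 0 <= F c)%E -> (forall c, 0 <= G c)%E ->
  (forall c, c k != 0 -> F c = G c) -> iter_int k.+1 F = iter_int k.+1 G.
Proof.
move=> F0 G0 FG; apply/eqP; rewrite eq_le.
by rewrite !le_iter_int_off_hyperplane// => c ck; rewrite FG.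
Qed.

Section mixture_of_products.
Variables (g : nat -> R -> R -> R) (G : nat -> R -> R).
Hypothesis mg : forall i, measurable_fun setT (fun p : R * R => g i p.1 p.2).
Hypothesis g0 : forall i s r, 0 <= g i s r.
Hypothesis gG : forall i r, (\int[mu]_s (g i s r)%:E = (G i r)%:E)%E.

Lemma factor_integral_ge0 i r : 0 <= G i r.
Proof. by rewrite -lee_fin -gG; apply: integral_ge0 => s _; rewrite lee_fin. Qed.

Lemma measurable_factor_integral i : measurable_fun setT (G i).
Proof.
apply/measurable_EFinP.
have -> : EFin \o G i = fubini_G mu (fun p : R * R => (g i p.1 p.2)%:E).
  by apply/funext => r; rewrite /fubini_G/= gG.
apply: measurable_fun_fubini_tonelli_G; last by move=> p; rewrite lee_fin.
by apply/measurable_EFinP; exact: mg.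
Qed.

Lemma tonelli_factor i (q : R -> R) : measurable_fun setT q -> (forall r, 0 <= q r) ->
  (\int[mu]_s \int[mu]_r (q r * g i s r)%:E = \int[mu]_r (q r * G i r)%:E)%E.
Proof.
move=> mq q0; pose f (p : R * R) := (q p.2 * g i p.1 p.2)%:E.
have mf : measurable_fun setT f.
  apply/measurable_EFinP; apply: measurable_funM => //.
  exact: measurableT_comp mq measurable_snd.
have f0 p : (0 <= f p)%E by rewrite lee_fin mulr_ge0.
rewrite (@fubini_tonelli _ _ _ _ R mu mu f mf f0); apply: eq_integral => r _.
under eq_integral do rewrite /f /= EFinM.
rewrite ge0_integralZl//=; first by rewrite gG.
- by apply/measurable_EFinP; exact: (measurableT_comp (mg i) (measurable_pair2 r)).
- by move=> s _; rewrite lee_fin.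
- by rewrite lee_fin.
Qed.

Lemma prod_last_coord k c s r :
  \prod_(i < k.+1) g i (if nat_of_ord i == k then s else c i) r =
  g k s r * \prod_(i < k) g i (c i) r.
Proof.
rewrite big_ord_recr /= eqxx mulrC; congr (_ * _).
by apply: eq_bigr => i _; rewrite ltn_eqF.
Qed.

Lemma iter_int_mixture k (q : R -> R) : measurable_fun setT q -> (forall r, 0 <= q r) ->
  iter_int k (fun c => \int[mu]_r (q r * \prod_(i < k) g i (c i) r)%:E)%E =
  (\int[mu]_r (q r * \prod_(i < k) G i r)%:E)%E.
Proof.
elim: k q => [|k IHk] q mq q0 /=.
  by apply: eq_integral => r _; rewrite !big_ord0.
transitivity (\int[mu]_s \int[mu]_r ((q r * \prod_(i < k) G i r) * g k s r)%:E)%E.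
  apply: eq_integral => s _.
  transitivity (iter_int k (fun c =>
      \int[mu]_r ((q r * g k s r) * \prod_(i < k) g i (c i) r)%:E)%E).
    apply: eq_iter_int => c; apply: eq_integral => r _.
    by rewrite prod_last_coord mulrA.
  rewrite IHk.
  - by apply: eq_integral => r _; rewrite mulrAC.
  - apply: measurable_funM => //.
    exact: (measurableT_comp (mg k) (measurable_pair1 s)).
  - by move=> r; rewrite mulr_ge0.
rewrite tonelli_factor => [||r].
- by apply: eq_integral => r _; rewrite big_ord_recr /= mulrA.
- apply: measurable_funM => //.
  by apply: measurable_prod => i _; exact: measurable_factor_integral.
- by rewrite mulr_ge0// prodr_ge0// => i _; exact: factor_integral_ge0.
Qed.

End mixture_of_products.

Lemma le_Rn_int n (F G : 'rV[R]_n -> \bar R) : (forall y, 0 <= F y)%E ->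
  (forall y, F y <= G y)%E -> (Rn_int F <= Rn_int G)%E.
Proof. by move=> F0 FG; apply: le_iter_int. Qed.

(* The origin is exempted because the mixtures used for negative powers of the
   norm diverge there, whereas powR 0 has the junk value 0. *)
Lemma Rn_int_mixture n (g : 'I_n -> R -> R -> R) (G : 'I_n -> R -> R) (q : R -> R)
    (F : 'rV[R]_n -> \bar R) : (0 < n)%N ->
  (forall i, measurable_fun setT (fun p : R * R => g i p.1 p.2)) ->
  (forall i s r, 0 <= g i s r) ->
  (forall i r, (\int[mu]_s (g i s r)%:E = (G i r)%:E)%E) ->
  measurable_fun setT q -> (forall r, 0 <= q r) -> (forall y, 0 <= F y)%E ->
  (forall y, y != 0 ->
    F y = (\int[mu]_r (q r * \prod_(i < n) g i (y ord0 i) r)%:E)%E) ->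
  Rn_int F = (\int[mu]_r (q r * \prod_(i < n) G i r)%:E)%E.
Proof.
case: n g G F => // n g G F _ mg g0 gG mq q0 F0 FE.
pose g' (i : nat) := g (inord i); pose G' (i : nat) := G (inord i).
transitivity (\int[mu]_r (q r * \prod_(i < n.+1) G' i r)%:E)%E; last first.
  by apply: eq_integral => r _; under eq_bigr do rewrite /G' inord_val.
rewrite -(@iter_int_mixture g' G' (fun=> mg _) (fun=> g0 _) (fun=> gG _))//.
apply: eq_iter_int_off_hyperplane => // [c|c cn].
  apply: integral_ge0 => r _; rewrite lee_fin mulr_ge0// prodr_ge0// => i _.
  exact: g0.
rewrite FE.
  apply: eq_integral => r _; congr (_ * _)%:E.
  by apply: eq_bigr => i _; rewrite /g' inord_val mxE.
by apply: contra cn => /eqP/rowP/(_ ord_max); rewrite !mxE => ->.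
Qed.

Lemma Rn_int_powR_prod n (C A p : R) (h : 'I_n -> R -> R) (H : 'I_n -> R -> R) :
  (0 < n)%N -> 0 <= C -> 0 <= A -> 0 < p ->
  (forall i, measurable_fun setT (h i)) -> (forall i s, 0 <= h i s) ->
  (forall i r, (\int[mu]_s (h i s * expR (- (expR r * s ^+ 2)))%:E = (H i r)%:E)%E) ->
  Rn_int (fun y : 'rV[R]_n =>
    (C * \prod_(i < n) h i (y ord0 i) * powR (A + enorm y ^+ 2) (- p))%:E) =
  (\int[mu]_r (C / euler_gamma p * gamma_integrand p A r * \prod_(i < n) H i r)%:E)%E.
Proof.
move=> n0 C0 A0 p0 mh h0 hH; have G0 := euler_gamma_gt0 p0.
have CG0 : 0 <= C / euler_gamma p by rewrite divr_ge0// ltW.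
have ph0 (y : 'rV[R]_n) : 0 <= \prod_(i < n) h i (y ord0 i) by rewrite prodr_ge0.
apply: (@Rn_int_mixture _ (fun i s r => h i s * expR (- (expR r * s ^+ 2)))) => //.
- move=> i; apply: measurable_funM.
    exact: (measurableT_comp (mh i) measurable_fst).
  do 2 apply: measurableT_comp => //; apply: measurable_funM.
    by apply: measurableT_comp => //; exact: measurable_snd.
  by apply: measurable_funX; exact: measurable_fst.
- by move=> i s r; rewrite mulr_ge0 ?expR_ge0.
- by apply: measurable_funM => //; exact: measurable_gamma_integrand.
- by move=> r; rewrite mulr_ge0 ?expR_ge0.
- by move=> y; rewrite lee_fin mulr_ge0 ?powR_ge0// mulr_ge0.
move=> y y0; have Ay : 0 < A + enorm y ^+ 2.
  by rewrite ltr_wpDl// exprn_gt0// enorm_gt0.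
transitivity (\int[mu]_r (C * \prod_(i < n) h i (y ord0 i) / euler_gamma p *
    gamma_integrand p (A + enorm y ^+ 2) r)%:E)%E; last first.
  apply: eq_integral => r _; congr (_%:E); rewrite big_split /= -expR_sum.
  rewrite sumrN -mulr_sumr -enorm_sqr /gamma_integrand mulrDl opprD addrA.
  by rewrite [expR (_ - enorm y ^+ 2 * _)]expRD (mulrC (expR r)); ring.
rewrite integral_EFinZ//; last exact: integrable_gamma_integrand.
by rewrite /Rintegral integral_gamma_integrand//= mulrA divfK// gt_eqF.
Qed.

End iterated_integrals.

(** * The Kummer representation of the solution *)

Section gaussian_integrals.
Context {R : realType}.
Notation mu := (@lebesgue_measure R).

Lemma powR_half_nat (x : R) n : 0 < x ->
  powR x (- (n%:R / 2)) = (Num.sqrt x)^-1 ^+ n.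
Proof.
move=> x0; rewrite powRN mulrC powRrM powR12_sqrt ?ltW//.
by rewrite powR_mulrn ?sqrtr_ge0// exprVn.
Qed.

Lemma integral_gauss (a m : R) : 0 < a ->
  (\int[mu]_s (expR (- (a * (s - m) ^+ 2)))%:E = (Num.sqrt (pi / a))%:E)%E.
Proof.
move=> a0; pose sigma := (Num.sqrt (2 * a))^-1.
have a2 : 0 < 2 * a by rewrite mulr_gt0.
have sigma0 : sigma != 0 by rewrite invr_eq0 gt_eqF// sqrtr_gt0.
have sigma2 : sigma ^+ 2 = (2 * a)^-1 by rewrite exprVn sqr_sqrtr// ltW.
have peak0 := normal_peak_gt0 sigma0.
transitivity (\int[mu]_s ((normal_peak sigma)^-1 * normal_pdf m sigma s)%:E)%E.
  apply: eq_integral => s _; rewrite normal_pdfE// mulrA mulVf ?gt_eqF// mul1r.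
  by rewrite /normal_fun sigma2; congr (expR _)%:E; field; rewrite gt_eqF.
rewrite integral_EFinZ//; last exact: integrable_normal_pdf.
rewrite /Rintegral integral_normal_pdf mulr1 /normal_peak invrK sigma2.
by congr (Num.sqrt _)%:E; field; rewrite gt_eqF.
Qed.

Definition heat_kernel1 (t s : R) : R :=
  (Num.sqrt (4 * pi * t))^-1 * expR (- (s ^+ 2 / (4 * t))).

Lemma heat_kernel1_ge0 t s : 0 <= heat_kernel1 t s.
Proof. by rewrite mulr_ge0 ?expR_ge0// invr_ge0 sqrtr_ge0. Qed.

Lemma measurable_heat_kernel1 t : measurable_fun setT (heat_kernel1 t).
Proof.
apply: measurable_funM => //; do 2 apply: measurableT_comp => //.
by apply: measurable_funM => //; exact: measurable_funX.
Qed.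

Lemma heat_kernel_prod n (x : 'rV[R]_n) t : 0 < t ->
  heat_kernel x t = \prod_(i < n) heat_kernel1 t (x ord0 i).
Proof.
move=> t0; rewrite /heat_kernel t0 powR_half_nat ?mulr_gt0 ?pi_gt0//.
rewrite big_split /= prodr_const card_ord -expR_sum enorm_sqr.
by rewrite sumrN -mulr_suml mulNr.
Qed.

Lemma integral_heat_kernel1_gauss t x l : 0 < t -> 0 <= l ->
  (\int[mu]_s (heat_kernel1 t (x - s) * expR (- (l * s ^+ 2)))%:E =
   ((Num.sqrt (1 + 4 * t * l))^-1 * expR (- (l * x ^+ 2 / (1 + 4 * t * l))))%:E)%E.
Proof.
move=> t0 l0; have t4 : 0 < 4 * t by rewrite mulr_gt0.
have tl0 : 0 < 1 + 4 * t * l by rewrite ltr_wpDr// mulr_ge0// ltW.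
pose a := (1 + 4 * t * l) / (4 * t); pose m := x / (1 + 4 * t * l).
have a0 : 0 < a by rewrite divr_gt0.
pose k := (Num.sqrt (4 * pi * t))^-1 * expR (- (l * x ^+ 2 / (1 + 4 * t * l))).
transitivity (\int[mu]_s (k * expR (- (a * (s - m) ^+ 2)))%:E)%E.
  apply: eq_integral => s _; rewrite /heat_kernel1 -!mulrA -!expRD.
  by congr (_ * expR _)%:E; rewrite /a /m; field; rewrite !gt_eqF.
under eq_integral do rewrite EFinM.
rewrite ge0_integralZl//=.
- rewrite integral_gauss// -EFinM mulrAC; congr (_ * _)%:E.
  have pi0 := pi_gt0 R.
  rewrite -!sqrtrV ?mulr_ge0 ?ltW// -sqrtrM ?invr_ge0 ?mulr_ge0 ?ltW//; congr Num.sqrt.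
  by rewrite /a; move: (pi : R) pi0 => P P0; field; rewrite !gt_eqF.
- apply/measurable_EFinP; do 2 apply: measurableT_comp => //.
  by apply: measurable_funM => //; apply: measurable_funX; exact: measurable_funB.
- by rewrite lee_fin mulr_ge0 ?expR_ge0// invr_ge0 sqrtr_ge0.
Qed.

End gaussian_integrals.

Section kummer_representation.
Context {R : realType}.
Notation mu := (@lebesgue_measure R).
Variable n : nat.
Hypothesis n0 : (0 < n)%N.

Lemma Psi_extE (g : R) (x : 'rV[R]_n) (t : R) : 0 < g -> g < n%:R / 2 -> 0 < t ->
  Psi_ext g x t = (powR (4 * t) (- g) / euler_gamma g *
    kummer g (n%:R / 2 - g) (enorm x ^+ 2 / (4 * t)))%:E.
Proof.
move=> g0 gn t0; have t4 : 0 < 4 * t by rewrite mulr_gt0.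
have G0 := euler_gamma_gt0 g0.
have e0 r : 0 < 1 + 4 * t * expR r by rewrite ltr_wpDr// mulr_ge0 ?expR_ge0// ltW.
pose h (i : 'I_n) (s : R) := heat_kernel1 t (x ord0 i - s).
transitivity (Rn_int (fun y : 'rV[R]_n =>
    (1 * \prod_(i < n) h i (y ord0 i) * powR (0 + enorm y ^+ 2) (- g))%:E)).
  congr (Rn_int _); apply/funext => y; rewrite heat_kernel_prod// mul1r add0r.
  rewrite -powR_mulrn ?sqrtr_ge0// -powRrM mulrN; congr (_ * _)%:E.
  by apply: eq_bigr => i _; rewrite !mxE.
rewrite (@Rn_int_powR_prod _ _ _ _ _ h (fun i r => (Num.sqrt (1 + 4 * t * expR r))^-1 *
  expR (- (expR r * x ord0 i ^+ 2 / (1 + 4 * t * expR r)))))//; last 3 first.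
- move=> i; apply: (measurableT_comp (measurable_heat_kernel1 t)).
  exact: measurable_funB.
- by move=> i s; exact: heat_kernel1_ge0.
- by move=> i r; rewrite integral_heat_kernel1_gauss ?expR_ge0.
pose K s := powR (4 * t) (- g) / euler_gamma g *
  kummer_integrand g (n%:R / 2 - g) (enorm x ^+ 2 / (4 * t)) s.
transitivity (\int[mu]_r (K (r + ln (4 * t)))%:E)%E.
  apply: eq_integral => r _; rewrite /K kummer_integrand_shift//.
  rewrite big_split /= prodr_const card_ord -expR_sum sumrN -mulr_suml -mulr_sumr.
  rewrite -enorm_sqr subrKC powR_half_nat// /gamma_integrand mul0r subr0 powRN.
  congr (_%:E).
  by field; rewrite !gt_eqF ?powR_gt0.
have int_k := integrable_kummer_integrand (enorm x ^+ 2 / (4 * t)) g0.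
rewrite (@ge0_integral_shift _ (EFin \o K)) => [||s].
- by rewrite /K /= integral_EFinZ//; apply: int_k; rewrite subr_gt0.
- apply/measurable_EFinP; apply: measurable_funM => //.
  by apply: continuous_measurable_fun; exact: continuous_kummer_integrand.
- rewrite lee_fin mulr_ge0 ?(ltW (kummer_integrand_gt0 _ _ _ _))//.
  by rewrite divr_ge0 ?powR_ge0// ltW.
Qed.

Lemma Rn_int_powR (C A p : R) : 0 <= C -> 0 < A -> n%:R / 2 < p ->
  Rn_int (fun x : 'rV[R]_n => (C * powR (A + enorm x ^+ 2) (- p))%:E) =
  (C * (Num.sqrt pi ^+ n * euler_gamma (p - n%:R / 2) / euler_gamma p) *
    powR A (- (p - n%:R / 2)))%:E.
Proof.
move=> C0 A0 np; have p0 : 0 < p by apply: le_lt_trans np; rewrite divr_ge0.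
transitivity (Rn_int (fun y : 'rV[R]_n =>
    (C * \prod_(i < n) 1 * powR (A + enorm y ^+ 2) (- p))%:E)).
  by congr (Rn_int _); apply/funext => y; rewrite big1 ?mulr1.
rewrite (@Rn_int_powR_prod _ _ _ _ _ (fun=> cst 1)
  (fun i r => Num.sqrt (pi / expR r)))//; last 2 first.
- exact: ltW.
- move=> i r; rewrite -(integral_gauss 0 (expR_gt0 r)).
  by apply: eq_integral => s _; rewrite mul1r subr0.
transitivity (\int[mu]_r (C / euler_gamma p * Num.sqrt pi ^+ n *
    gamma_integrand (p - n%:R / 2) A r)%:E)%E.
  apply: eq_integral => r _; rewrite prodr_const card_ord; congr (_%:E).
  rewrite sqrtrM ?pi_ge0// exprMn sqrtrV ?expR_ge0// -powR_half_nat ?expR_gt0//.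
  rewrite -mulrA [X in _ * X]mulrCA !mulrA -[LHS]mulrA; congr (_ * _).
  by rewrite -expRM /gamma_integrand -expRD; congr expR; ring.
rewrite integral_EFinZ//; last by apply: integrable_gamma_integrand; rewrite ?subr_gt0.
by rewrite /Rintegral integral_gamma_integrand ?subr_gt0//=; congr (_%:E); ring.
Qed.

End kummer_representation.

(** * Smoothness and the heat equation *)

Section directional_derivatives.
Context {R : realType} {V : normedModType R}.
Implicit Types (f : V -> R) (p v : V).

Lemma is_derive_affine f p v (c : R) :
  (forall e : R, f (e *: v + p) = e * c + f p) -> is_derive p v f c.
Proof.
move=> fE; have cvgc : h^-1 *: ((f \o shift p) (h *: v) - f p) @[h --> 0^'] --> c.
  apply: cvg_near_cst; near=> h.
  rewrite /= fE addrK /GRing.scale/= mulrA mulVf ?mul1r//.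
  by near: h; exact: nbhs_dnbhs_neq.
by apply: DeriveDef; [apply/cvg_ex; exists c|exact: cvg_lim].
Unshelve. all: by end_near. Qed.

Lemma differentiable_comp1 f (h : R -> R) p (c : R) :
  differentiable f p -> is_derive (f p) 1 h c -> differentiable (h \o f) p.
Proof.
by move=> df [/derivable1_diffP dh _]; exact: differentiable_comp.
Qed.

Lemma is_derive_comp1 f (h : R -> R) p v (df c : R) :
  differentiable f p -> is_derive p v f df -> is_derive (f p) 1 h c ->
  is_derive p v (h \o f) (c * df).
Proof.
move=> dif [_ <-] dh; have dhf := differentiable_comp1 dif dh.
case: dh => dh <-; have dh1 : differentiable h (f p) by exact/derivable1_diffP.
apply: DeriveDef; first exact: diff_derivable.
rewrite [LHS]deriveE// diff_comp//=.
by rewrite [X in _ * X]deriveE// deriv1E// derive1E mulrC.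
Qed.

(* [iterD] alone would denote the lemma of ssrnat. *)
Lemma smooth_on_derive_stable (U : set V) (A : set (V -> R)) (u f : V -> R) :
  open U ->
  (forall h p, A h -> U p -> differentiable h p) ->
  (forall h v, A h -> exists2 h', A h' & forall p, U p -> 'D_v h p = h' p) ->
  A f -> {in U, u =1 f} -> smooth_on U u.
Proof.
move=> oU dA DA Af uf.
have nearU p (w h : V -> R) : U p -> {in U, w =1 h} -> \near p, w p = h p.
  move=> Up wh; near=> q; apply: wh; rewrite inE.
  by near: q; exact: open_nbhs_nbhs.
have iterA vs : exists2 h, A h & {in U, Defs.iterD vs u =1 h}.
  elim: vs => [|v vs [h Ah uh]]; first by exists f.
  have [h' Ah' Dh] := DA h v Ah; exists h' => // p /[!inE] Up /=.
  by rewrite -Dh//; apply: near_eq_derive; exact: nearU.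
move=> vs p Up; have [h Ah uh] := iterA vs; have nuh := nearU _ _ _ Up uh.
have nhu : \near p, h p = Defs.iterD vs u p by apply: filterS nuh => q ->.
split=> [|v].
  rewrite /prop_for /continuous_at uh ?inE//.
  apply: cvg_trans (differentiable_continuous (dA h p Ah Up)).
  exact: near_eq_cvg.
exact: near_eq_derivable nhu (diff_derivable (dA h p Ah Up)).
Unshelve. all: by end_near. Qed.

End directional_derivatives.

Section kummer_profiles.
Context {R : realType} {n : nat}.
Notation V := ('rV[R]_n * R)%type.
Implicit Types (p v : V) (alpha a b : R).

Lemma differentiable_coord1 i p : differentiable (fun p : V => p.1 ord0 i) p.
Proof.
apply: (@differentiable_comp _ _ _ _ (fst : V -> 'rV[R]_n) (fun M => M ord0 i)).
  by apply: linear_differentiable => q; exact: cvg_fst.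
exact: differentiable_coord.
Qed.

Lemma is_derive_coord1 i p v : is_derive p v (fun p : V => p.1 ord0 i) (v.1 ord0 i).
Proof. by apply: is_derive_affine => e; rewrite !mxE. Qed.

Lemma differentiable_snd p : differentiable (snd : V -> R) p.
Proof. by apply: linear_differentiable => q; exact: cvg_snd. Qed.

Lemma is_derive_snd p v : is_derive p v (snd : V -> R) v.2.
Proof. exact: is_derive_affine. Qed.

Lemma enorm_sqr_fctE : (fun p : V => enorm p.1 ^+ 2) =
  \sum_(i < n) ((fun p : V => p.1 ord0 i) * (fun p : V => p.1 ord0 i)).
Proof.
apply/funext => p; rewrite enorm_sqr fct_sumE.
by apply: eq_bigr => i _; rewrite expr2.
Qed.

Lemma differentiable_enorm_sqr p : differentiable (fun p : V => enorm p.1 ^+ 2) p.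
Proof.
rewrite enorm_sqr_fctE; apply: differentiable_sum => i.
by apply: differentiableM; exact: differentiable_coord1.
Qed.

Lemma is_derive_enorm_sqr p v :
  is_derive p v (fun p : V => enorm p.1 ^+ 2) (2 * dot p.1 v.1).
Proof.
rewrite enorm_sqr_fctE.
have d i := is_deriveM (is_derive_coord1 i p v) (is_derive_coord1 i p v).
apply: (is_derive_eq (is_derive_sum d)).
by rewrite /dot mulr_sumr; apply: eq_bigr => i _; rewrite /GRing.scale/=; ring.
Qed.

Definition parabolic_ratio p : R := enorm p.1 ^+ 2 / (4 * p.2).

Lemma parabolic_ratioE : parabolic_ratio =
  4^-1 *: ((fun p => enorm p.1 ^+ 2) * ((fun t => t^-1) \o snd)).
Proof. by apply/funext => p; rewrite /parabolic_ratio invfM mulrCA. Qed.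

Lemma is_derive_snd_inv p v : p.2 != 0 ->
  is_derive p v ((fun t : R => t^-1) \o snd) (- p.2 ^- 2 * v.2).
Proof.
move=> p0; have dV := is_deriveV p0 (is_derive_id p.2 1).
apply: is_derive_eq (is_derive_comp1 (differentiable_snd p) (is_derive_snd p v) dV) _.
by rewrite /GRing.scale/= mulr1.
Qed.

Lemma differentiable_snd_inv p : p.2 != 0 ->
  differentiable ((fun t : R => t^-1) \o snd : V -> R) p.
Proof.
move=> p0.
exact: differentiable_comp1 (differentiable_snd p) (is_deriveV p0 (is_derive_id p.2 1)).
Qed.

Lemma differentiable_parabolic_ratio p : p.2 != 0 -> differentiable parabolic_ratio p.
Proof.
move=> p0; rewrite parabolic_ratioE; apply: differentiableZ; apply: differentiableM.
  exact: differentiable_enorm_sqr.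
exact: differentiable_snd_inv.
Qed.

Lemma is_derive_parabolic_ratio p v : p.2 != 0 -> is_derive p v parabolic_ratio
  (dot p.1 v.1 / (2 * p.2) - enorm p.1 ^+ 2 * v.2 / (4 * p.2 ^+ 2)).
Proof.
move=> p0; rewrite parabolic_ratioE.
have d := is_deriveM (is_derive_enorm_sqr p v) (is_derive_snd_inv v p0).
apply: is_derive_eq (is_deriveZ 4^-1 d) _.
by rewrite /GRing.scale/= /GRing.scale/=; field.
Qed.

Definition kummer_profile alpha a b p : R :=
  powR p.2 alpha * kummer a b (parabolic_ratio p).

Lemma differentiable_kummer_profile alpha a b p : 0 < a -> 0 < b -> 0 < p.2 ->
  differentiable (kummer_profile alpha a b) p.
Proof.
move=> a0 b0 p0; apply: differentiableM.
  exact: differentiable_comp1 (differentiable_snd p) (is_derive1_powR alpha p0).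
apply: differentiable_comp1 (is_derive_kummer _ a0 b0).
by apply: differentiable_parabolic_ratio; rewrite gt_eqF.
Qed.

Lemma is_derive_kummer_profile alpha a b p v : 0 < a -> 0 < b -> 0 < p.2 ->
  is_derive p v (kummer_profile alpha a b)
    (v.2 * alpha * kummer_profile (alpha - 1) a b p
     - 2^-1 * dot p.1 v.1 * kummer_profile (alpha - 1) (a + 1) b p
     + 4^-1 * v.2 * enorm p.1 ^+ 2 * kummer_profile (alpha - 2) (a + 1) b p).
Proof.
move=> a0 b0 p0; have pn : p.2 != 0 by rewrite gt_eqF.
have dpow := is_derive_comp1 (differentiable_snd p) (is_derive_snd p v)
  (is_derive1_powR alpha p0).
have dkum := is_derive_comp1 (differentiable_parabolic_ratio pn)
  (is_derive_parabolic_ratio v pn) (is_derive_kummer (parabolic_ratio p) a0 b0).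
apply: is_derive_eq (is_deriveM dpow dkum) _.
rewrite /kummer_profile !powRB ?pn ?implybT// powRr1 ?ltW// powR_mulrn ?ltW//.
rewrite /GRing.scale/= /GRing.scale/=.
by field.
Qed.

Inductive profile_alg (b : R) : (V -> R) -> Prop :=
| profile_alg_cst c : profile_alg b (cst c)
| profile_alg_coord i : profile_alg b (fun p => p.1 ord0 i)
| profile_alg_kummer alpha a : 0 < a -> profile_alg b (kummer_profile alpha a b)
| profile_alg_add f h : profile_alg b f -> profile_alg b h -> profile_alg b (f + h)
| profile_alg_mul f h : profile_alg b f -> profile_alg b h -> profile_alg b (f * h).

Lemma profile_alg_sum b (f : 'I_n -> V -> R) :
  (forall i, profile_alg b (f i)) -> profile_alg b (\sum_(i < n) f i).
Proof.
move=> Af; elim/big_ind : _ => [|h k|i _] //; first exact: profile_alg_cst.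
exact: profile_alg_add.
Qed.

Lemma profile_alg_dot b (x : 'rV[R]_n) : profile_alg b (fun p => dot p.1 x).
Proof.
have -> : (fun p => dot p.1 x) =
    \sum_(i < n) ((fun p : V => p.1 ord0 i) * cst (x ord0 i)).
  by apply/funext => p; rewrite /dot fct_sumE.
apply: profile_alg_sum => i.
by apply: profile_alg_mul; [exact: profile_alg_coord|exact: profile_alg_cst].
Qed.

Lemma profile_alg_enorm_sqr b : profile_alg b (fun p => enorm p.1 ^+ 2).
Proof.
rewrite enorm_sqr_fctE; apply: profile_alg_sum => i.
by apply: profile_alg_mul; exact: profile_alg_coord.
Qed.

Lemma profile_alg_differentiable b f p : 0 < b -> profile_alg b f -> 0 < p.2 ->
  differentiable f p.
Proof.
move=> b0 + p0; elim=> {f} [c|i|alpha a a0|f h _ df _ dh|f h _ df _ dh].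
- exact: differentiable_cst.
- exact: differentiable_coord1.
- exact: differentiable_kummer_profile.
- exact: differentiableD.
- exact: differentiableM.
Qed.

Lemma profile_alg_derive b f v : 0 < b -> profile_alg b f ->
  exists2 f', profile_alg b f' & forall p, 0 < p.2 -> 'D_v f p = f' p.
Proof.
move=> b0; elim=> {f} [c|i|alpha a a0|f h Af [f' Af' Df] Ah [h' Ah' Dh]
  |f h Af [f' Af' Df] Ah [h' Ah' Dh]].
- by exists (cst 0) => [|p _]; [exact: profile_alg_cst|rewrite derive_cst].
- exists (cst (v.1 ord0 i)) => [|p _]; first exact: profile_alg_cst.
  by have [_ ->] := is_derive_coord1 i p v.
- exists (cst (v.2 * alpha) * kummer_profile (alpha - 1) a b
    + cst (- 2^-1) * (fun p => dot p.1 v.1) * kummer_profile (alpha - 1) (a + 1) b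
    + cst (4^-1 * v.2) * (fun p => enorm p.1 ^+ 2) *
      kummer_profile (alpha - 2) (a + 1) b).
    have a1 : 0 < a + 1 by rewrite addr_gt0.
    by do ?[exact: profile_alg_cst|exact: profile_alg_kummer|exact: profile_alg_dot
      |exact: profile_alg_enorm_sqr|apply: profile_alg_add|apply: profile_alg_mul].
  move=> p p0; have [_ ->] := is_derive_kummer_profile alpha v a0 b0 p0.
  by rewrite !fctE !mulNr.
- exists (f' + h') => [|p p0]; first exact: profile_alg_add.
  rewrite deriveD ?Df ?Dh//.
  + exact/diff_derivable/(profile_alg_differentiable b0 Af p0).
  + exact/diff_derivable/(profile_alg_differentiable b0 Ah p0).
- exists (f * h' + h * f') => [|p p0].
    by apply: profile_alg_add; exact: profile_alg_mul.
  rewrite deriveM ?Df ?Dh//.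
  + exact/diff_derivable/(profile_alg_differentiable b0 Af p0).
  + exact/diff_derivable/(profile_alg_differentiable b0 Ah p0).
Qed.

Lemma open_snd_gt0 : open [set p : V | 0 < p.2].
Proof.
apply: (@open_comp _ _ (snd : V -> R) [set t : R | 0 < t]); last exact: open_gt.
by move=> p _; exact: cvg_snd.
Qed.

Section heat_equation.
Variables (alpha a b c : R) (u : 'rV[R]_n -> R -> R).
Hypotheses (a0 : 0 < a) (b0 : 0 < b).
Hypothesis uE : forall x t, 0 < t -> u x t = c * kummer_profile alpha a b (x, t).

Lemma smooth_on_kummer_profile : smooth_on [set p : V | 0 < p.2] (uncurry_xt u).
Proof.
apply: (@smooth_on_derive_stable _ _ _ (profile_alg b) _
  (cst c * kummer_profile alpha a b)).
- exact: open_snd_gt0.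
- by move=> h p Ah p0; exact: profile_alg_differentiable Ah p0.
- by move=> h v Ah; exact: profile_alg_derive.
- by apply: profile_alg_mul; [exact: profile_alg_cst|exact: profile_alg_kummer].
- by move=> [x t] /[!inE]; exact: uE.
Qed.

Let near_uE p : 0 < p.2 ->
  \near p, (c *: kummer_profile alpha a b) p = uncurry_xt u p.
Proof.
move=> p0; have /= := open_nbhs_nbhs (conj open_snd_gt0 p0).
by apply: filterS => -[x t] /= t0; rewrite /uncurry_xt uE.
Qed.

Lemma dt_kummer_profile x t : 0 < t -> dt u x t =
  c * (alpha * kummer_profile (alpha - 1) a b (x, t)
       + 4^-1 * enorm x ^+ 2 * kummer_profile (alpha - 2) (a + 1) b (x, t)).
Proof.
move=> t0; rewrite /dt -(near_eq_derive _ (near_uE _))//.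
have d := is_derive_kummer_profile alpha (0, 1) a0 b0 (t0 : 0 < (x, t).2).
have [_ ->] := is_deriveZ c d.
by rewrite /= dotx0 /GRing.scale/=; ring.
Qed.

Let near_DuE p i : 0 < p.2 ->
  \near p, (- (c / 2) *: ((fun p : V => p.1 ord0 i) *
      kummer_profile (alpha - 1) (a + 1) b)) p =
    'D_((delta_mx ord0 i : 'rV[R]_n), (0 : R)) (uncurry_xt u) p.
Proof.
move=> p0; have /= := open_nbhs_nbhs (conj open_snd_gt0 p0).
apply: filterS => q /= q0; rewrite -(near_eq_derive _ (near_uE q0)).
have d := is_derive_kummer_profile alpha ((delta_mx ord0 i : 'rV[R]_n), 0) a0 b0 q0.
have [_ ->] := is_deriveZ c d.
by rewrite /= dot_delta_mx /GRing.scale/= /GRing.scale/= !fctE; field.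
Qed.

Lemma laplacian_kummer_profile x t : 0 < t -> laplacian u x t =
  c * (- (n%:R / 2) * kummer_profile (alpha - 1) (a + 1) b (x, t)
       + 4^-1 * enorm x ^+ 2 * kummer_profile (alpha - 2) (a + 2) b (x, t)).
Proof.
move=> t0; have a1 : 0 < a + 1 by rewrite addr_gt0.
transitivity (\sum_(i < n)
  c * (- 2^-1 * kummer_profile (alpha - 1) (a + 1) b (x, t)
       + 4^-1 * x ord0 i ^+ 2 * kummer_profile (alpha - 2) (a + 2) b (x, t))).
  apply: eq_bigr => i _; rewrite -(near_eq_derive _ (near_DuE i _))//.
  pose v : V := (delta_mx ord0 i, 0).
  have d := is_derive_kummer_profile (alpha - 1) v a1 b0 (t0 : 0 < (x, t).2).
  have [_ ->] := is_deriveZ (- (c / 2)) (is_deriveM (is_derive_coord1 i (x, t) v) d).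
  rewrite /= dot_delta_mx mxE !eqxx /GRing.scale/= /GRing.scale/=.
  rewrite (_ : alpha - 1 - 1 = alpha - 2); last by ring.
  by rewrite (_ : a + 1 + 1 = a + 2); [field|ring].
rewrite -mulr_sumr big_split /= sumr_const card_ord -mulr_natl.
by rewrite -mulr_suml -mulr_sumr -enorm_sqr; field.
Qed.

Lemma heat_kummer_profile x t : alpha = - a -> a + b = n%:R / 2 -> 0 < t ->
  dt u x t - laplacian u x t = 0.
Proof.
move=> alphaE abn t0; rewrite dt_kummer_profile// laplacian_kummer_profile//.
rewrite -abn alphaE.
have tn : t != 0 by rewrite gt_eqF.
rewrite /kummer_profile /=; set z := parabolic_ratio (x, t).
have -> : enorm x ^+ 2 = 4 * t * z by rewrite /z /parabolic_ratio /=; field.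
have -> : powR t (- a - 1) = t * powR t (- a - 2).
  rewrite (_ : - a - 1 = 1 + (- a - 2)); last by ring.
  by rewrite powRD ?tn ?implybT// powRr1// ltW.
have := kummer_ode z a0 b0.
move: (kummer a b z) (kummer (a + 1) b z) (kummer (a + 2) b z) => K0 K1 K2 ode.
transitivity (- c * t * powR t (- a - 2) *
  (a * K0 - (a + b + z) * K1 + z * K2)); last by rewrite ode mulr0.
by field.
Qed.

End heat_equation.

End kummer_profiles.

(** * The self-similar solution *)

Section self_similar_solution.
Context {R : realType} {n : nat}.
Variable g : R.
Hypotheses (n0 : (0 < n)%N) (g0 : 0 < g) (gn : g < n%:R / 2).
Notation mu := (@lebesgue_measure R).
Notation b := (n%:R / 2 - g).
Notation u := (Psi (n := n) g).

Let b0 : 0 < b. Proof. by rewrite subr_gt0. Qed.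

Definition Psi_cst : R := powR 4 (- g) / euler_gamma g.

Lemma Psi_cst_gt0 : 0 < Psi_cst.
Proof. by rewrite divr_gt0 ?powR_gt0 ?euler_gamma_gt0. Qed.

Lemma PsiE x t : 0 < t -> u x t = Psi_cst * kummer_profile (- g) g b (x, t).
Proof.
by move=> t0; rewrite /Psi Psi_extE//= /Psi_cst /kummer_profile powRM ?ltW//=; ring.
Qed.

Lemma Psi_gt0 x t : 0 < t -> 0 < u x t.
Proof.
move=> t0; rewrite PsiE// mulr_gt0 ?Psi_cst_gt0//.
by rewrite mulr_gt0 ?powR_gt0 ?kummer_gt0.
Qed.

Lemma powR_PsiE x t : 0 < t ->
  powR t g * u x t = Psi_cst * kummer g b (enorm x ^+ 2 / (4 * t)).
Proof.
move=> t0; rewrite PsiE// /kummer_profile /= powRN.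
by field; rewrite gt_eqF ?powR_gt0.
Qed.

Lemma Psi_origin t : 0 < t -> powR t g * u 0 t = u 0 1.
Proof.
have := powR_PsiE 0 ltr01; rewrite powR1 mul1r => -> t0.
by rewrite powR_PsiE// enorm0 expr0n !mul0r.
Qed.

Lemma Psi_parabolic_bounds x t : 0 < t -> enorm x < Num.sqrt t ->
  Psi_cst * kummer g b 4^-1 <= powR t g * u x t <= Psi_cst * kummer g b 0.
Proof.
move=> t0 xt; have t4 : 0 < 4 * t by rewrite mulr_gt0.
rewrite powR_PsiE// !ler_pM2l ?Psi_cst_gt0//.
apply/andP; split; apply: kummer_nonincreasing => //.
  rewrite ler_pdivrMr// mulrA mulVf// mul1r -[leRHS]sqr_sqrtr ?(ltW t0)//.
  by rewrite ler_sqr ?nnegrE ?sqrtr_ge0// ltW.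
by rewrite divr_ge0 ?sqr_ge0// ltW.
Qed.

Lemma Psi_le_powR : exists2 C, 0 < C & forall x t, 0 < t ->
  u x t <= C * powR (4 * t + enorm x ^+ 2) (- g).
Proof.
have [C C0 kummerC] := kummer_le_powR g0 b0; have G0 := euler_gamma_gt0 g0.
exists (C / euler_gamma g) => [|x t t0]; first by rewrite divr_gt0.
have t4 : 0 < 4 * t by rewrite mulr_gt0.
have z0 : 0 <= enorm x ^+ 2 / (4 * t) by rewrite divr_ge0 ?sqr_ge0// ltW.
have -> : 4 * t + enorm x ^+ 2 = 4 * t * (1 + enorm x ^+ 2 / (4 * t)).
  by field; rewrite gt_eqF.
rewrite powRM ?addr_ge0 ?(ltW t4)// /Psi Psi_extE//=.
have := kummerC _ z0; rewrite -(ler_pM2l (divr_gt0 (powR_gt0 (- g) t4) G0)).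
by congr (_ <= _); ring.
Qed.

Lemma Rn_int_Psi_le_powR lam : 0 < lam -> n%:R / 2 < g * lam ->
  exists2 B, 0 <= B & forall t, 0 < t ->
    (Rn_int (fun x => (powR `|u x t| lam)%:E) <=
     (B * powR t (- (g * lam - n%:R / 2)))%:E)%E.
Proof.
move=> l0 np; have [C C0 PsiC] := Psi_le_powR.
have p0 : 0 < g * lam by rewrite mulr_gt0.
pose I := Num.sqrt pi ^+ n * euler_gamma (g * lam - n%:R / 2) /
  euler_gamma (g * lam).
exists (powR C lam * I * powR 4 (- (g * lam - n%:R / 2))) => [|t t0].
  rewrite !mulr_ge0 ?powR_ge0 ?exprn_ge0 ?sqrtr_ge0 ?invr_ge0//.
    by rewrite ltW ?euler_gamma_gt0 ?subr_gt0.
  by rewrite ltW ?euler_gamma_gt0.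
have t4 : 0 < 4 * t by rewrite mulr_gt0.
rewrite -[_ * powR 4 _ * _]mulrA -powRM ?(ltW t0)//.
rewrite -(Rn_int_powR n0 _ t4 np) ?powR_ge0//.
apply: le_Rn_int => x; rewrite lee_fin ?powR_ge0// gtr0_norm ?Psi_gt0//.
rewrite -mulNr powRrM -powRM ?powR_ge0 ?(ltW C0)//.
apply: ge0_ler_powR; rewrite ?nnegrE ?PsiC//.
- exact: ltW.
- exact/ltW/Psi_gt0.
- by rewrite mulr_ge0 ?powR_ge0// ltW.
Qed.

Lemma Psi_Lpower_lty (lam T : R) : 0 < lam -> n%:R / 2 < g * lam ->
  g * lam < n%:R / 2 + 1 -> 0 < T ->
  (\int[mu]_(t in [set t : R | (0 < t < T)%R])
     Rn_int (fun x => (powR `|u x t| lam)%:E) < +oo)%E.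
Proof.
move=> l0 np pn T0; pose k := g * lam - n%:R / 2.
have k1 : k < 1 by rewrite ltrBlDl.
have [B B0 PsiB] := Rn_int_Psi_le_powR l0 np.
apply: (@le_lt_trans _ _ (\int[mu]_(t in `]0%R, T]) (B * powR t (- k))%:E)%E).
  rewrite integral_mkcond [leRHS]integral_mkcond.
  have f0 t : (0 <= Rn_int (fun x => (powR `|u x t| lam)%:E))%E.
    by apply: iter_int_ge0 => c; rewrite lee_fin powR_ge0.
  apply: nneg_ae_le_integral => [t _|t _|].
  - exact: erestrict_ge0.
  - by apply: erestrict_ge0 => s _; rewrite lee_fin mulr_ge0 ?powR_ge0.
  - apply: aeW => t _; rewrite !patchE; case: ifPn => [/[!inE] /andP[t0 tT]|_].
      by rewrite ifT ?PsiB// inE/= in_itv/= t0 ltW.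
    by case: ifPn => // _; rewrite lee_fin mulr_ge0 ?powR_ge0.
under eq_integral do rewrite EFinM.
rewrite ge0_integralZl//=.
- by apply: lte_mul_pinfty => //; exact: integral_powRN_lty.
- by apply/measurable_EFinP/measurable_funTS; exact: measurable_powR.
- by move=> t _; rewrite lee_fin powR_ge0.
Qed.

End self_similar_solution.

Theorem theorem5p2 (R : realType) (n : nat) (lam eps gamma : R) :
  (1 <= n)%N ->
  (n%:R + 2) / n%:R <= lam ->
  0 < eps < 1 ->
  gamma = (n%:R + 2 - eps) / (2 * lam) ->
  let u := Psi (n := n) gamma in
  (* Psi is finite and positive *)
  (forall x t, 0 < t -> (Psi_ext gamma x t < +oo)%E /\ 0 < u x t) /\
  (* C^infinity on R^n x (0,oo) *)
  smooth_on [set p : 'rV[R]_n * R | 0 < p.2] (uncurry_xt u) /\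
  (* solves the heat equation *)
  (forall x t, 0 < t -> dt u x t - laplacian u x t = 0) /\
  (* u in L^lam(R^n x (0,T)) for every T > 0 *)
  (forall T : R, 0 < T ->
     (\int[@lebesgue_measure R]_(t in [set t : R | (0 < t < T)%R])
         Rn_int (fun x => (powR `|u x t| lam)%:E) < +oo)%E) /\
  (* self-similarity at x = 0 *)
  (forall t, 0 < t -> powR t gamma * u 0 t = u 0 1) /\
  (* two-sided bound on the parabolic region |x| < sqrt t *)
  (exists c1 c2 : R, 0 < c1 /\ 0 < c2 /\
     forall x t, 0 < t -> enorm x < Num.sqrt t ->
       c1 <= powR t gamma * u x t <= c2).
Proof.
move=> n0 lamn /andP[eps0 eps1] gammaE u.
have n1 : 0 < n%:R :> R by rewrite ltr0n.
have lam0 : 0 < lam by apply: lt_le_trans lamn; rewrite divr_gt0// addr_gt0.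
have lamn2 : n%:R + 2 <= lam * n%:R by rewrite -ler_pdivrMr.
have gamma0 : 0 < gamma by rewrite gammaE divr_gt0 ?mulr_gt0//; lra.
have gamma_lam : gamma * lam = (n%:R + 2 - eps) / 2.
  by rewrite gammaE; field; rewrite gt_eqF.
have gamman : gamma < n%:R / 2 by rewrite -(ltr_pM2r lam0) gamma_lam; nra.
have b0 : 0 < n%:R / 2 - gamma by rewrite subr_gt0.
have uE := PsiE n0 gamma0 gamman.
split; first by move=> x t t0; rewrite Psi_extE// ltry; split => //; exact: Psi_gt0.
split; first exact: smooth_on_kummer_profile uE.
split; first by move=> x t; apply: (heat_kummer_profile _ _ uE); rewrite ?subrKC.
split; first by move=> T T0; apply: Psi_Lpower_lty; rewrite ?gamma_lam//; lra.
split; first by move=> t t0; exact: Psi_origin.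
pose bound z := Psi_cst gamma * kummer gamma (n%:R / 2 - gamma) z.
have bound0 z : 0 < bound z by rewrite mulr_gt0 ?Psi_cst_gt0 ?kummer_gt0.
exists (bound 4^-1), (bound 0); do 2 split => //.
by move=> x t; exact: Psi_parabolic_bounds.
Qed.
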